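(* Let $n\ge 3$. In the virtual singular braid group $VSG_n$, for all $1\le i\le n-2$: $$\sigma_i\sigma_{i+1}v_i\neq v_{i+1}\sigma_i\sigma_{i+1},\qquad v_i\sigma_{i+1}\sigma_i\neq\sigma_{i+1}\sigma_iv_{i+1},$$ $$\tau_i\sigma_{i+1}v_i\neq v_{i+1}\sigma_i\tau_{i+1},\qquad v_i\sigma_{i+1}\tau_i\neq\tau_{i+1}\sigma_iv_{i+1}.$$
   Context: For $n\ge 2$, $VSG_n$ is the group with generators $\sigma_1,\dots,\sigma_{n-1},\tau_1,\dots,\tau_{n-1},v_1,\dots,v_{n-1}$ and relations (for all admissible indices): $\sigma_i\sigma_j=\sigma_j\sigma_i$, $v_iv_j=v_jv_i$, $\tau_i\tau_j=\tau_j\tau_i$, $\sigma_i\tau_j=\tau_j\sigma_i$, $\sigma_iv_j=v_j\sigma_i$, $\tau_iv_j=v_j\tau_i$ whenever $|i-j|\ge 2$; $v_i^2=1$ and $\sigma_i\tau_i=\tau_i\sigma_i$ for $1\le i\le n-1$; and for $1\le i\le n-2$: $\sigma_i\sigma_{i+1}\sigma_i=\sigma_{i+1}\sigma_i\sigma_{i+1}$, $v_iv_{i+1}v_i=v_{i+1}v_iv_{i+1}$, $\sigma_i\sigma_{i+1}\tau_i=\tau_{i+1}\sigma_i\sigma_{i+1}$, $\sigma_{i+1}\sigma_i\tau_{i+1}=\tau_i\sigma_{i+1}\sigma_i$, $v_i\sigma_{i+1}v_i=v_{i+1}\sigma_iv_{i+1}$, $v_i\tau_{i+1}v_i=v_{i+1}\tau_iv_{i+1}$.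 *)

(* Defs.v *)
From HB Require Import structures.
From mathcomp Require Import all_boot.
From mathcomp Require Import boolp.

Set Implicit Arguments.
Unset Strict Implicit.
Unset Printing Implicit Defensive.

Local Open Scope quotient_scope.

(* A letter (x, b) stands for x if b = false and for x^-1 if b = true. *)
Definition word (X : Type) := seq (X * bool).

Definition pos_word (X : Type) (s : seq X) : word X :=
  [seq (x, false) | x <- s].

Definition inv_word (X : Type) (w : word X) : word X :=
  rev [seq (l.1, ~~ l.2) | l <- w].

(* The relators are given as a relation R between words: R u v means that
   u = v is one of the defining relations. *)
Inductive pres_eq (X : Type) (R : word X -> word X -> Prop) :
    word X -> word X -> Prop :=
| pres_rel u v : R u v -> pres_eq R u v
| pres_cancel x b : pres_eq R [:: (x, b); (x, ~~ b)] [::]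
| pres_refl u : pres_eq R u u
| pres_sym u v : pres_eq R u v -> pres_eq R v u
| pres_trans u v w : pres_eq R u v -> pres_eq R v w -> pres_eq R u w
| pres_cat u u' v v' : pres_eq R u u' -> pres_eq R v v' ->
    pres_eq R (u ++ v) (u' ++ v').

Section Presentation.
Variables (X : choiceType) (R : word X -> word X -> Prop).

(* boolp turns the Prop-valued congruence into the boolean relation required by
   generic quotients. *)
Definition pres_eqb (u v : word X) : bool := `[< pres_eq R u v >].

Lemma pres_eqb_refl : reflexive pres_eqb.
Proof. by move=> u; apply/asboolP; apply: pres_refl. Qed.

Lemma pres_eqb_sym : symmetric pres_eqb.
Proof. by move=> u v; apply/asboolP/asboolP; apply: pres_sym. Qed.

Lemma pres_eqb_trans : transitive pres_eqb.
Proof.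
move=> v u w /asboolP uv /asboolP vw; apply/asboolP.
exact: pres_trans uv vw.
Qed.

Canonical pres_equiv :=
  EquivRel pres_eqb pres_eqb_refl pres_eqb_sym pres_eqb_trans.

Definition presented := {eq_quot pres_equiv}.
HB.instance Definition _ := Choice.on presented.

Definition pres_pi (w : word X) : presented := \pi_presented w.

Lemma pres_piP (u v : word X) : pres_pi u = pres_pi v <-> pres_eq R u v.
Proof.
rewrite /pres_pi; split; first by move/eqmodP/asboolP.
by move=> uv; apply/eqmodP/asboolP.
Qed.

Lemma pres_reprK (g : presented) : pres_pi (repr g) = g.
Proof. exact: reprK. Qed.

Lemma inv_wordK (w : word X) : inv_word (inv_word w) = w.
Proof.
rewrite /inv_word map_rev revK -map_comp -[RHS]map_id.
by apply: eq_map => -[x b] /=; rewrite negbK.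
Qed.

Lemma pres_inv_catr (w : word X) : pres_eq R (w ++ inv_word w) [::].
Proof.
elim: w => [|[x b] w IH]; first exact: pres_refl.
have -> : inv_word ((x, b) :: w) = inv_word w ++ [:: (x, ~~ b)].
  by rewrite /inv_word /= rev_cons cats1.
apply: pres_trans (pres_cancel R x b).
rewrite cat_cons catA.
exact: (pres_cat (pres_refl R [:: (x, b)])
                 (pres_cat IH (pres_refl R [:: (x, ~~ b)]))).
Qed.

Lemma pres_inv_catl (w : word X) : pres_eq R (inv_word w ++ w) [::].
Proof. by rewrite -{2}[w]inv_wordK; apply: pres_inv_catr. Qed.

Lemma pres_inv (u v : word X) :
  pres_eq R u v -> pres_eq R (inv_word u) (inv_word v).
Proof.
move=> uv; apply: (@pres_trans _ _ _ (inv_word u ++ (v ++ inv_word v))).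
  rewrite -{1}[inv_word u]cats0; apply: pres_cat; first exact: pres_refl.
  exact/pres_sym/pres_inv_catr.
rewrite catA -[X in pres_eq _ _ X]cat0s; apply: pres_cat (pres_refl _ _).
apply: pres_trans (pres_inv_catl u).
by apply: pres_cat; [apply: pres_refl | apply: pres_sym].
Qed.

Definition pres_one : presented := pres_pi [::].
Definition pres_mul (g h : presented) : presented :=
  pres_pi (repr g ++ repr h).
Definition pres_invg (g : presented) : presented :=
  pres_pi (inv_word (repr g)).

Lemma pres_mul_pi (u v : word X) :
  pres_mul (pres_pi u) (pres_pi v) = pres_pi (u ++ v).
Proof. by apply/pres_piP/pres_cat; apply/pres_piP; apply: pres_reprK. Qed.

Lemma pres_invg_pi (u : word X) : pres_invg (pres_pi u) = pres_pi (inv_word u).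
Proof. by apply/pres_piP/pres_inv/pres_piP; apply: pres_reprK. Qed.

Lemma pres_mulA : associative pres_mul.
Proof.
move=> f g h; rewrite -[f]pres_reprK -[g]pres_reprK -[h]pres_reprK.
by rewrite !pres_mul_pi catA.
Qed.

Lemma pres_mul1g : left_id pres_one pres_mul.
Proof. by move=> g; rewrite -[g]pres_reprK pres_mul_pi. Qed.

Lemma pres_mulg1 : right_id pres_one pres_mul.
Proof. by move=> g; rewrite -[g]pres_reprK pres_mul_pi cats0. Qed.

Lemma pres_mulVg : left_inverse pres_one pres_invg pres_mul.
Proof.
move=> g; rewrite -[g]pres_reprK pres_invg_pi pres_mul_pi.
exact/pres_piP/pres_inv_catl.
Qed.

Lemma pres_mulgV : right_inverse pres_one pres_invg pres_mul.
Proof.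
move=> g; rewrite -[g]pres_reprK pres_invg_pi pres_mul_pi.
exact/pres_piP/pres_inv_catr.
Qed.

HB.instance Definition _ := isGroup.Build presented
  pres_mulA pres_mul1g pres_mulg1 pres_mulVg pres_mulgV.

Definition pres_gen (x : X) : presented := pres_pi [:: (x, false)].

Local Open Scope group_scope.

Lemma pres_piM (u v : word X) : pres_pi (u ++ v) = pres_pi u * pres_pi v.
Proof. exact: (esym (pres_mul_pi u v)). Qed.

Lemma pres_piV (u : word X) : pres_pi (inv_word u) = (pres_pi u)^-1.
Proof. exact: (esym (pres_invg_pi u)). Qed.

Section UniversalProperty.
Variables (G : groupType) (f : X -> G).

Definition word_eval (w : word X) : G :=
  \prod_(l <- w) (if l.2 then (f l.1)^-1 else f l.1).

Hypothesis fR : forall u v, R u v -> word_eval u = word_eval v.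

Lemma word_eval_pres_eq (u v : word X) :
  pres_eq R u v -> word_eval u = word_eval v.
Proof.
elim=> {u v} [u v /fR//|x b|//|u v _ ->//|u v w _ -> _ ->//|].
  rewrite /word_eval !big_cons !big_nil /= mulg1.
  by case: b; rewrite /= ?mulgV ?mulVg.
move=> u u' v v' _ eu _ ev.
by rewrite /word_eval !big_cat /= -!/(word_eval _) eu ev.
Qed.

Definition pres_lift (g : presented) : G := word_eval (repr g).

Lemma pres_lift_pi (w : word X) : pres_lift (pres_pi w) = word_eval w.
Proof. by apply/word_eval_pres_eq/pres_piP; apply: pres_reprK. Qed.

Lemma pres_lift_gen (x : X) : pres_lift (pres_gen x) = f x.
Proof. by rewrite pres_lift_pi /word_eval big_seq1. Qed.

Lemma pres_liftM : {morph pres_lift : g h / g * h}.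
Proof.
move=> g h; rewrite -[g]pres_reprK -[h]pres_reprK -pres_piM !pres_lift_pi.
by rewrite /word_eval big_cat.
Qed.

End UniversalProperty.

End Presentation.

(* The generators are indexed from 0: for i : 'I_n.-1, Sigma i is the
   generator usually written sigma_(i+1), and similarly for Tau and Virt. *)
Inductive vsg_gen (n : nat) :=
  Sigma of 'I_n.-1 | Tau of 'I_n.-1 | Virt of 'I_n.-1.

Definition vsg_gen_code n (x : vsg_gen n) : 'I_n.-1 + 'I_n.-1 + 'I_n.-1 :=
  match x with
  | Sigma i => inl (inl i) | Tau i => inl (inr i) | Virt i => inr i
  end.

Definition vsg_gen_decode n (y : 'I_n.-1 + 'I_n.-1 + 'I_n.-1) : vsg_gen n :=
  match y with
  | inl (inl i) => Sigma i | inl (inr i) => Tau i | inr i => Virt i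
  end.

Lemma vsg_gen_codeK n : cancel (@vsg_gen_code n) (@vsg_gen_decode n).
Proof. by case. Qed.

HB.instance Definition _ n := Choice.copy (vsg_gen n)
  (can_type (@vsg_gen_codeK n)).

Definition far n (i j : 'I_n.-1) : bool := (i.+1 < j) || (j.+1 < i).

Definition adjacent n (i j : 'I_n.-1) : Prop := j = i.+1 :> nat.

Inductive vsg_relation (n : nat) : seq (vsg_gen n) -> seq (vsg_gen n) -> Prop :=
| vsg_ss_far i j : far i j ->
    vsg_relation [:: Sigma i; Sigma j] [:: Sigma j; Sigma i]
| vsg_vv_far i j : far i j ->
    vsg_relation [:: Virt i; Virt j] [:: Virt j; Virt i]
| vsg_tt_far i j : far i j ->
    vsg_relation [:: Tau i; Tau j] [:: Tau j; Tau i]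
| vsg_st_far i j : far i j ->
    vsg_relation [:: Sigma i; Tau j] [:: Tau j; Sigma i]
| vsg_sv_far i j : far i j ->
    vsg_relation [:: Sigma i; Virt j] [:: Virt j; Sigma i]
| vsg_tv_far i j : far i j ->
    vsg_relation [:: Tau i; Virt j] [:: Virt j; Tau i]
| vsg_vv i : vsg_relation [:: Virt i; Virt i] [::]
| vsg_st i : vsg_relation [:: Sigma i; Tau i] [:: Tau i; Sigma i]
| vsg_sss i j : adjacent i j ->
    vsg_relation [:: Sigma i; Sigma j; Sigma i] [:: Sigma j; Sigma i; Sigma j]
| vsg_vvv i j : adjacent i j ->
    vsg_relation [:: Virt i; Virt j; Virt i] [:: Virt j; Virt i; Virt j]
| vsg_sst i j : adjacent i j ->
    vsg_relation [:: Sigma i; Sigma j; Tau i] [:: Tau j; Sigma i; Sigma j]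
| vsg_sst' i j : adjacent i j ->
    vsg_relation [:: Sigma j; Sigma i; Tau j] [:: Tau i; Sigma j; Sigma i]
| vsg_vsv i j : adjacent i j ->
    vsg_relation [:: Virt i; Sigma j; Virt i] [:: Virt j; Sigma i; Virt j]
| vsg_vtv i j : adjacent i j ->
    vsg_relation [:: Virt i; Tau j; Virt i] [:: Virt j; Tau i; Virt j].

Inductive vsg_word_relation (n : nat) :
    word (vsg_gen n) -> word (vsg_gen n) -> Prop :=
| VsgWordRelation s t : vsg_relation s t ->
    vsg_word_relation (pos_word s) (pos_word t).

Definition VSG (n : nat) : groupType := presented (@vsg_word_relation n).

Definition sigma n (i : 'I_n.-1) : VSG n := pres_gen _ (Sigma i).
Definition tau n (i : 'I_n.-1) : VSG n := pres_gen _ (Tau i).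
Definition virt n (i : 'I_n.-1) : VSG n := pres_gen _ (Virt i).

(* Main.v *)
(* Braids act on colourings of the n strands by a set-theoretic solution of the
   Yang-Baxter equation: sigma_i and tau_i both transform the colours (a, b) of
   strands i, i+1 into (s b, t a + (1 - s t) b), and v_i exchanges them. All
   relations of VSG_n hold for this action, whereas the forbidden relations with
   sigma sigma v and v sigma sigma hold only if (1 - s t) (t - 1) = 0 and
   (1 - s t) (s - 1) = 0 respectively. Over the field with five elements,
   s = t = 2 violates both, and the relations with tau reduce to these. *)
Require Import Defs.
From mathcomp Require Import all_boot all_fingroup all_algebra ring zify.

Set Implicit Arguments.
Unset Strict Implicit.
Unset Printing Implicit Defensive.

Import GRing.Theory.

(** * Maps changing a colouring at two points *)

Definition on12 (D : Type) (g : D * D -> D * D) (z : D * D * D) : D * D * D :=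
  (g z.1, z.2).

Definition on23 (D : Type) (g : D * D -> D * D) (z : D * D * D) : D * D * D :=
  let w := g (z.1.2, z.2) in (z.1.1, w.1, w.2).

Definition triple (I D : Type) (p q r : I) (f : I -> D) : D * D * D :=
  (f p, f q, f r).

Section LocalMap.
Variables (I D : finType).
Implicit Types (p q r x : I) (g h : D * D -> D * D) (f : {ffun I -> D}).

Definition local_map g p q f : {ffun I -> D} :=
  [ffun x => if x == p then (g (f p, f q)).1
             else if x == q then (g (f p, f q)).2 else f x].

(** The image records [g (f p, f q)] at the distinct points [p] and [q], and [f] itself
    elsewhere. *)
Lemma local_map_inj g p q :
  p != q -> injective g -> injective (local_map g p q).
Proof.
move=> pq g_inj f f' /ffunP E.
have [Ep Eq] : f p = f' p /\ f q = f' q.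
  have: g (f p, f q) = g (f' p, f' q).
    have := E q; have := E p; rewrite !ffunE !eqxx [q == p]eq_sym (negPf pq).
    by case: (g _) (g _) => [a b] [c d] /= -> ->.
  by move/g_inj => -[].
apply/ffunP=> x; have := E x; rewrite !ffunE.
by case: eqP => [->|_] //; case: eqP => [->|].
Qed.

Lemma local_map_involutive g p q :
  p != q -> involutive g -> involutive (local_map g p q).
Proof.
move=> pq gK f; apply/ffunP=> x.
rewrite !ffunE !eqxx [q == p]eq_sym (negPf pq) -surjective_pairing gK.
by case: eqP => [->|_] //; case: eqP => [->|].
Qed.

Lemma local_map_comm g h p q p' q' f :
    p != p' -> p != q' -> q != p' -> q != q' ->
  local_map g p q (local_map h p' q' f) = local_map h p' q' (local_map g p q f).
Proof.
move=> pp pq qp qq; apply/ffunP=> x; rewrite !ffunE.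
rewrite ![p' == _]eq_sym ![q' == _]eq_sym.
rewrite (negPf pp) (negPf pq) (negPf qp) (negPf qq).
case: (eqVneq x p) => [->|_]; first by rewrite (negPf pp) (negPf pq).
by case: (eqVneq x q) => [->|_]; first by rewrite (negPf qp) (negPf qq).
Qed.

Section Triple.
Variables (p q r : I).
Hypotheses (pq : p != q) (qr : q != r) (pr : p != r).

Lemma triple_local_map12 g f :
  triple p q r (local_map g p q f) = on12 g (triple p q r f).
Proof.
rewrite /triple /on12 !ffunE !eqxx [q == p]eq_sym ![r == _]eq_sym.
by rewrite (negPf pq) (negPf qr) (negPf pr) -surjective_pairing.
Qed.

Lemma triple_local_map23 g f :
  triple p q r (local_map g q r f) = on23 g (triple p q r f).
Proof.
rewrite /triple /on23 !ffunE !eqxx ![r == _]eq_sym.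
by rewrite (negPf pq) (negPf qr) (negPf pr).
Qed.

(** Both sides fix every coordinate other than [p], [q], [r], so an identity on [D * D * D]
    suffices. *)
Lemma local_map3 g1 g2 g3 h1 h2 h3 f :
    (forall z, on12 g3 (on23 g2 (on12 g1 z)) = on23 h3 (on12 h2 (on23 h1 z))) ->
  local_map g3 p q (local_map g2 q r (local_map g1 p q f)) =
  local_map h3 q r (local_map h2 p q (local_map h1 q r f)).
Proof.
move=> /(_ (triple p q r f)).
rewrite -!(triple_local_map12, triple_local_map23) => -[Ep Eq Er].
apply/ffunP=> x; have [->//|xp] := eqVneq x p; have [->//|xq] := eqVneq x q.
have [->//|xr] := eqVneq x r.
by rewrite !ffunE (negPf xp) (negPf xq) (negPf xr).
Qed.

End Triple.

End LocalMap.

(** * The two solutions of the Yang-Baxter equation *)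

Definition swap (D : Type) (z : D * D) : D * D := (z.2, z.1).

(** The switch of the Alexander biquandle; [s = 1] gives the Burau form [(b, t a + (1 - t) b)]. *)
Definition biquandle (K : nzRingType) (s t : K) (z : K * K) : K * K :=
  (s * z.2, t * z.1 + (1 - s * t) * z.2)%R.

Lemma swap_inj (D : Type) : injective (@swap D).
Proof. by move=> [a b] [c d] [-> ->]. Qed.

(** Cancelling [s] in the first component recovers [z.2]; then cancelling [t] in the second recovers
    [z.1]. *)
Lemma biquandle_inj (K : fieldType) (s t : K) :
  s != 0%R -> t != 0%R -> injective (biquandle s t).
Proof.
move=> s0 t0 [a b] [c d] [/(mulfI s0) ->].
by move/addIr/(mulfI t0) => ->.
Qed.

Lemma biquandle_braid (K : comNzRingType) (s t : K) (z : K * K * K) :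
  let g := biquandle s t in
  on12 g (on23 g (on12 g z)) = on23 g (on12 g (on23 g z)).
Proof. by case: z => [[a b] c]; congr (_, _, _) => /=; ring. Qed.

(** * The action of the generators on colourings *)

Section Action.
Variables (n : nat) (K : finFieldType) (s t : K).
Hypotheses (s0 : s != 0%R) (t0 : t != 0%R).
Implicit Types i j : 'I_n.-1.

Lemma strand_subproof i : i.+1 < n.
Proof. by case: n i => [|m] [i ?]. Qed.

Definition strand i : 'I_n := Ordinal (ltnW (strand_subproof i)).
Definition next_strand i : 'I_n := Ordinal (strand_subproof i).

Lemma strand_neq i : strand i != next_strand i.
Proof. by rewrite -val_eqE /= ltn_eqF. Qed.

(** As [K] is finite, colourings form a finite type and an injective local map is a permutation.
    Products apply the left factor first, so words act from left to right. *)
Definition local_perm (g : K * K -> K * K) (g_inj : injective g) i :=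
  perm (local_map_inj (strand_neq i) g_inj).

Lemma local_perm_far g (g_inj : injective g) h (h_inj : injective h) i j :
  far i j -> (local_perm g_inj i * local_perm h_inj j =
              local_perm h_inj j * local_perm g_inj i)%g.
Proof.
move=> ij; apply/permP=> f; rewrite !permM !permE.
apply: local_map_comm; rewrite -val_eqE /=; move: ij; rewrite /far; lia.
Qed.

Section Adjacent.
Variables (i j : 'I_n.-1) (ij : adjacent i j).

Lemma strand_adjacent : strand j = next_strand i.
Proof. exact: val_inj. Qed.

Lemma adjacent_neq : strand i != next_strand j.
Proof. by rewrite -val_eqE /= ij ltn_eqF. Qed.

Definition colours (f : {ffun 'I_n -> K}) :=
  triple (strand i) (strand j) (next_strand j) f.

Lemma strand_neq_adjacent : strand i != strand j.
Proof. by rewrite strand_adjacent strand_neq. Qed.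

Lemma colours_fst g (g_inj : injective g) f :
  colours (local_perm g_inj i f) = on12 g (colours f).
Proof.
rewrite permE -strand_adjacent.
exact: triple_local_map12 strand_neq_adjacent (strand_neq j) adjacent_neq _ _.
Qed.

Lemma colours_snd g (g_inj : injective g) f :
  colours (local_perm g_inj j f) = on23 g (colours f).
Proof.
rewrite permE.
exact: triple_local_map23 strand_neq_adjacent (strand_neq j) adjacent_neq _ _.
Qed.

(** The three strands are distinct, so their colours can be prescribed freely; this provides test
    colourings for the forbidden relations. *)
Lemma colours_surj z : exists f : {ffun 'I_n -> K}, colours f = z.
Proof.
case: z => [[a b] c].
exists [ffun x => if x == strand i then a else if x == strand j then b else c].
rewrite /colours /triple !ffunE !eqxx.
rewrite [strand j == _]eq_sym ![next_strand j == _]eq_sym.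
rewrite (negPf strand_neq_adjacent) (negPf adjacent_neq).
by rewrite (negPf (strand_neq j)).
Qed.

Lemma local_perm3 g1 g2 g3 h1 h2 h3 (g1_inj : injective g1)
    (g2_inj : injective g2) (g3_inj : injective g3) (h1_inj : injective h1)
    (h2_inj : injective h2) (h3_inj : injective h3) :
    (forall z, on12 g3 (on23 g2 (on12 g1 z)) = on23 h3 (on12 h2 (on23 h1 z))) ->
  (local_perm g1_inj i * local_perm g2_inj j * local_perm g3_inj i =
   local_perm h1_inj j * local_perm h2_inj i * local_perm h3_inj j)%g.
Proof.
move=> gh; apply/permP=> f; rewrite !permM !permE -strand_adjacent.
apply: local_map3 gh; first exact: strand_neq_adjacent.
  exact: strand_neq.
exact: adjacent_neq.
Qed.

End Adjacent.

(** Since [Sigma] and [Tau] share their image, [vsg_st] becomes trivial and [vsg_sst], [vsg_sst']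
    become the braid relation. *)
Definition vsg_action (x : vsg_gen n) : {perm {ffun 'I_n -> K}} :=
  match x with
  | Sigma i | Tau i => local_perm (biquandle_inj s0 t0) i
  | Virt i => local_perm (@swap_inj K) i
  end.

Lemma word_eval_pos (G : groupType) (X : choiceType) (f : X -> G) (w : seq X) :
  word_eval f (pos_word w) = (\prod_(x <- w) f x)%g.
Proof. by rewrite /word_eval big_map. Qed.

Lemma vsg_action_rel u v : vsg_word_relation u v ->
  word_eval vsg_action u = word_eval vsg_action v.
Proof.
have E2 (G : groupType) (x y : G) : (x * (y * 1) = x * y)%g by rewrite mulg1.
have E3 (G : groupType) (x y z : G) : (x * (y * (z * 1)) = x * y * z)%g.
  by rewrite mulg1 mulgA.
case=> {u v} u v r; rewrite !word_eval_pos.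
case: r => [i j ij|i j ij|i j ij|i j ij|i j ij|i j ij|i|i|i j ij|i j ij|i j ij|
            i j ij|i j ij|i j ij]; rewrite !big_cons !big_nil ?E3 ?E2 /=.
all: try exact: local_perm_far.
(* With the triple destructured, the adjacent relations containing [Virt] hold by computation. *)
all: try by apply: (local_perm3 ij) => -[[a b] c].
all: try by apply: (local_perm3 ij); apply: biquandle_braid.
(* What is left is [vsg_vv], [vsg_st] and [vsg_sst']; the last is the braid relation with its sides
   exchanged. *)
- apply/permP=> f; rewrite permM perm1 !permE.
  by apply: local_map_involutive (strand_neq i) _ _ => -[].
- by [].
- by symmetry; apply: (local_perm3 ij); apply: biquandle_braid.
Qed.

Definition vsg_rep : VSG n -> {perm {ffun 'I_n -> K}} :=
  pres_lift vsg_action.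

Lemma vsg_repM : {morph vsg_rep : g h / (g * h)%g}.
Proof. exact: (pres_liftM vsg_action_rel). Qed.

Lemma vsg_rep_gen x : vsg_rep (pres_gen _ x) = vsg_action x.
Proof. exact: (pres_lift_gen vsg_action_rel). Qed.

Section Forbidden.
Variables (i j : 'I_n.-1).
Hypotheses (ij : adjacent i j) (st : (1 - s * t != 0)%R).

Let S k := local_perm (biquandle_inj s0 t0) k.
Let V k := local_perm (@swap_inj K) k.

Lemma forbidden_ssv : t != 1%R -> (S i * S j * V i <> V j * S i * S j)%g.
Proof.
(* From colours [(0, 0, 1)] the third strand ends with [1 - s t] on the left and [t (1 - s t)] on
   the right. *)
rewrite eq_sym -subr_eq0 => t1 E; have [f fE] := colours_surj ij (0, 0, 1)%R.
have := congr1 (fun u : {perm _} => (colours i j (u f)).2) E.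
rewrite !permM !(colours_fst ij, colours_snd ij) fE /= => /eqP.
apply/negP; rewrite -subr_eq0.
have := mulf_neq0 st t1; congr (_ != _); ring.
Qed.

Lemma forbidden_vss : s != 1%R -> (V i * S j * S i <> S j * S i * V j)%g.
Proof.
(* Here the middle strand separates the sides: [s (1 - s t)] against [1 - s t]. *)
rewrite -subr_eq0 => s1 E; have [f fE] := colours_surj ij (0, 0, 1)%R.
have := congr1 (fun u : {perm _} => (colours i j (u f)).1.2) E.
rewrite !permM !(colours_fst ij, colours_snd ij) fE /= => /eqP.
apply/negP; rewrite -subr_eq0.
have := mulf_neq0 st s1; congr (_ != _); ring.
Qed.

End Forbidden.

End Action.


Local Open Scope group_scope.

Theorem theorem29 (n : nat) (hn : (3 <= n)%N) (i j : 'I_n.-1)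
    (hij : j = i.+1 :> nat) :
  [/\ sigma i * sigma j * virt i <> virt j * sigma i * sigma j,
      virt i * sigma j * sigma i <> sigma j * sigma i * virt j,
      tau i * sigma j * virt i <> virt j * sigma i * tau j &
      virt i * sigma j * tau i <> tau j * sigma i * virt j].
Proof.
(* Five is the least prime that works: ['F_2] has only 0 and 1, and in ['F_3] the only choice
   [s = t = 2] gives [s t = 1]. *)
have t0 : (2 : 'F_5)%R != 0%R by [].
have t1 : (2 : 'F_5)%R != 1%R by [].
have st : (1 - 2 * 2 : 'F_5)%R != 0%R by [].
by split=> /(congr1 (vsg_rep t0 t0)); rewrite !vsg_repM !vsg_rep_gen;
  [apply: forbidden_ssv | apply: forbidden_vss
  |apply: forbidden_ssv | apply: forbidden_vss].
Qed.
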